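(* Let $\mathcal F$ be a filter on $\omega$ extending the cofinite filter. For every ${\bf\Sigma}^1_1$ set $A\subseteq\omega^\omega$, either there exists $H\in\mathbb H_{\mathcal F}$ with $[H]\cap A=\emptyset$, or there exists $L\in\mathbb L_{\mathcal F}$ with $[L]\subseteq A$.
   Context: A subtree of $\omega^{<\omega}$ is a nonempty subset closed under initial segments; $sn$ denotes the one-term extension of $s$ by $n$; $[T]=\{x\in\omega^\omega:\forall n\ x\upharpoonright n\in T\}$. $\mathcal F^+$ denotes the set of $X\subseteq\omega$ whose complement is not in $\mathcal F$. $\mathbb H_{\mathcal F}$ is the set of subtrees $H\subseteq\omega^{<\omega}$ such that for every $s\in H$, $\{n: sn\in H\}\in\mathcal F$. $\mathbb L_{\mathcal F}$ is the set of subtrees $L\subseteq\omega^{<\omega}$ such that for every $s\in L$, $\{n: sn\in L\}\in\mathcal F^+$. *)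

(* Defs.v *)
From HB Require Import structures.
From mathcomp Require Import all_boot all_order all_algebra.
From mathcomp Require Import all_classical all_reals topology.

Set Implicit Arguments.
Unset Strict Implicit.
Unset Printing Implicit Defensive.

Local Open Scope classical_set_scope.

(* The canonical topology on [nat] is the discrete one, so this is
   omega^omega with its usual product topology. *)
Notation baire := {ptws nat -> nat}.

Definition subtree (T : set (seq nat)) : Prop :=
  T !=set0 /\ forall s t : seq nat, prefix s t -> T t -> T s.

(* [mkseq x n] is the restriction of [x] to its first [n] values. *)
Definition branches (T : set (seq nat)) : set baire :=
  [set x : baire | forall n : nat, T (mkseq x n)].

Definition succs (T : set (seq nat)) (s : seq nat) : set nat :=
  [set n : nat | T (rcons s n)].

Definition positive (F : set_system nat) : set_system nat :=
  [set X : set nat | ~ F (~` X)].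

Definition HF (F : set_system nat) : set (set (seq nat)) :=
  [set H | subtree H /\ forall s, H s -> F (succs H s)].

Definition LF (F : set_system nat) : set (set (seq nat)) :=
  [set L | subtree L /\ forall s, L s -> positive F (succs L s)].

(* Boldface Sigma^1_1: projections of closed subsets of
   omega^omega x omega^omega. *)
Definition Sigma11 (A : set baire) : Prop :=
  exists C : set (baire * baire)%type,
    closed C /\ A = [set x : baire | exists y : baire, C (x, y)].

(* Main.v *)
Require Import Defs.
From HB Require Import structures.
From mathcomp Require Import all_boot all_order all_algebra.
From mathcomp Require Import all_classical all_reals topology.

(** Write [A] as the projection of a closed set [C].  Call [P] unavoidable from
    [s] if no [F]-branching tree above [s] has all its branches outside [P],
    and suppose that the projection of the part of [C] over the cylinder of [t]
    is unavoidable from [s].  Then no [F]-branching tree above [s] avoids the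
    nodes [u] from which, for some [m], the projection over [rcons t m] is
    unavoidable: such a tree could be intersected, at each node [v], with the
    finitely many trees that avoid the projection over [rcons t m] from an
    initial segment of [v], for [m] at most its length; as every [m] is
    eventually accounted for, the result would avoid the projection over [t].
    By open determinacy, a positively branching tree above [s] leads to such
    nodes along all its branches.  Concatenating these trees gives [L], and the
    successive extensions of [t] met along a branch of [L] give a witness that
    the branch is in [A]. *)

Set Implicit Arguments.
Unset Strict Implicit.
Unset Printing Implicit Defensive.

Local Open Scope classical_set_scope.

Lemma take_mkseq T (x : nat -> T) i n :
  i <= n -> take i (mkseq x n) = mkseq x i.
Proof.
by move=> le_in; rewrite /mkseq -map_take take_iota (minn_idPl le_in).
Qed.

Lemma foldl_rcons_cat T (s t : seq T) : foldl rcons s t = s ++ t.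
Proof. by elim: t s => [|n t IH] s; rewrite ?cats0//= IH cat_rcons. Qed.

Lemma prefix_rconsr (T : eqType) (s t : seq T) a :
  prefix s (rcons t a) = (s == rcons t a) || prefix s t.
Proof.
apply/prefixP/orP => [[r]|[/eqP->|/prefixP[r ->]]]; last 2 first.
- by exists [::]; rewrite cats0.
- by exists (rcons r a); rewrite rcons_cat.
elim/last_ind: r => [|r b _]; first by rewrite cats0 => ->; left.
by rewrite -rcons_cat => /rcons_inj[-> _]; right; rewrite prefix_prefix.
Qed.

Lemma prefix_nth (T : eqType) (a : T) (s t : seq T) i :
  prefix s t -> i < size s -> nth a t i = nth a s i.
Proof. by move=> /prefixP[r ->] i_s; rewrite nth_cat i_s. Qed.

Definition cylinder (s : seq nat) : set baire :=
  [set x : baire | mkseq x (size s) = s].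

Lemma cylinderP (s : seq nat) (x : baire) :
  cylinder s x <-> forall i, i < size s -> x i = nth 0 s i.
Proof.
split=> [xs i i_s|xs]; first by rewrite -xs nth_mkseq.
apply: (@eq_from_nth _ 0) => [|i]; rewrite size_mkseq// => i_s.
by rewrite nth_mkseq// xs.
Qed.

Lemma cylinder_mkseq (x : baire) n : cylinder (mkseq x n) x.
Proof. by rewrite /cylinder/= size_mkseq. Qed.

Lemma cylinder_rcons (s : seq nat) (x : baire) :
  cylinder s x -> cylinder (rcons s (x (size s))) x.
Proof. by move=> xs; rewrite /cylinder/= size_rcons mkseqS xs. Qed.

Lemma open_cylinder (s : seq nat) : open (cylinder s).
Proof.
rewrite openE => x /cylinderP xs; rewrite /interior.
have coord i : \forall z \near x, (z : baire) i = x i.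
  exact: (@proj_continuous nat (fun=> nat) i x [set x i]).
have := filter_forall (nbhs_filter x) (fun i : 'I_(size s) => coord i).
apply: filterS => z zx; apply/cylinderP => i i_s.
by rewrite (zx (Ordinal i_s))/= xs.
Qed.

Lemma cvg_cylinder (u : nat -> seq nat) (x : baire) (f : nat -> baire) :
  (forall k, k <= size (u k)) -> (forall k, cylinder (u k) x) ->
  (forall k, cylinder (u k) (f k)) -> f k @[k --> \oo] --> x.
Proof.
move=> u_ge ux uf; apply/pointwise_cvgP => i; apply/discrete_cvg.
exists i.+1 => // k /= lt_ik; have i_uk := leq_trans lt_ik (u_ge k).
have /cylinderP/(_ i i_uk) xi := ux k; have /cylinderP/(_ i i_uk) fi := uf k.
by rewrite fi xi.
Qed.

Lemma open_contains_cylinder (P : set baire) (x : baire) n :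
  open P -> P x -> exists2 k, n <= k & cylinder (mkseq x k) `<=` P.
Proof.
move=> openP Px; apply: contrapT => no_k.
have /choice[f fP] k : exists y, cylinder (mkseq x (n + k)) y /\ ~ P y.
  apply: contrapT => /forallNP nkP; apply: no_k; exists (n + k).
    exact: leq_addr.
  by move=> y yk; apply: contrapT => nPy; apply: (nkP y).
have f_cvg : f k @[k --> \oo] --> x.
  apply: (cvg_cylinder (u := fun k => mkseq x (n + k))) => k.
  - by rewrite size_mkseq leq_addl.
  - exact: cylinder_mkseq.
  - exact: (fP k).1.
suff : (~` P) x by apply.
apply: (closed_cvg _ (open_closedC openP)) f_cvg.
by apply: nearW => k; exact: (fP k).2.
Qed.

Lemma prefix_chain_branch (t : nat -> seq nat) :
  (forall k, prefix (t k) (t k.+1)) -> (forall k, k <= size (t k)) ->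
  exists y : baire, forall k, cylinder (t k) y.
Proof.
move=> tS t_ge; exists (fun i => nth 0 (t i.+1) i) => k.
have t_mono : {homo t : i j / i <= j >-> prefix i j}.
  exact: homo_leq (@prefix_refl _) (@prefix_trans _) tS.
apply/cylinderP => i i_tk.
have i_tS : i < size (t i.+1) by exact: t_ge.
rewrite -(prefix_nth 0 (t_mono _ _ (leq_maxl i.+1 k)) i_tS).
by rewrite (prefix_nth 0 (t_mono _ _ (leq_maxr i.+1 k)) i_tk).
Qed.

(* In the game behind [plays] and [forces], one player proposes the set
   [tau u] at each node [u] from [s] on, and the opponent picks an element of
   it as the next term of the play. *)
Definition plays (tau : seq nat -> set nat) (s : seq nat) : set baire :=
  [set x | cylinder s x /\ forall i, size s <= i -> tau (mkseq x i) (x i)].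

Definition forces (G : set_system nat) (s : seq nat) : set_system baire :=
  [set P | exists2 tau, forall u, G (tau u) & plays tau s `<=` P].

Lemma forces_tree (G : set_system nat) (P : set baire) :
  forces G [::] P -> exists2 T : set (seq nat), HF G T & branches T `<=` P.
Proof.
move=> [tau tauG tauP].
pose T := [set u | forall s n, prefix (rcons s n) u -> tau s n].
have succsT s : T s -> succs T s = tau s.
  move=> Ts; apply/seteqP; split=> [n Tsn|n taun v m].
    by apply: Tsn; exact: prefix_refl.
  by rewrite prefix_rconsr => /orP[/eqP/rcons_inj[-> ->]//|/Ts].
exists T; first split=> [|s /succsT -> //].
  split; first by exists [::] => s n; rewrite prefixs0 -size_eq0 size_rcons.
  by move=> s t st Tt v n /prefix_trans/(_ st); exact: Tt.
move=> x Tx; apply: tauP; split=> // i _; apply: (Tx i.+1).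
by rewrite mkseqS prefix_refl.
Qed.

Lemma forces_sub (G : set_system nat) (s : seq nat) (P Q : set baire) :
  P `<=` Q -> forces G s P -> forces G s Q.
Proof.
by move=> PQ [tau tauG tauP]; exists tau => //; exact: subset_trans PQ.
Qed.

Lemma forces_choice I (G : set_system nat) (s : I -> seq nat)
    (P : I -> set baire) :
  (forall i, forces G (s i) (P i)) ->
  exists2 tau : I -> seq nat -> set nat, forall i u, G (tau i u) &
    forall i, plays (tau i) (s i) `<=` P i.
Proof.
move=> GP; have /choice[tau tauP] : forall i, exists tau,
    (forall u, G (tau u)) /\ plays tau (s i) `<=` P i.
  by move=> i; have [tau] := GP i; exists tau.
by exists tau => [i u|i]; [apply: (tauP i).1|apply: (tauP i).2].
Qed.

Lemma forces_cylinder (G : set_system nat) (s : seq nat) (P : set baire) :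
  G setT -> cylinder s `<=` P -> forces G s P.
Proof. by move=> GT sP; exists (fun=> setT) => // x [/sP]. Qed.

Lemma not_forces_escape (G : set_system nat) (s : seq nat) (P : set baire) :
  G setT -> ~ forces G s P -> exists2 x, cylinder s x & ~ P x.
Proof.
move=> GT nsP; apply: contrapT => no_escape; apply/nsP/forces_cylinder => //.
by move=> x xs; apply: contrapT => nPx; apply: no_escape; exists x.
Qed.

Lemma forces_imply (G : set_system nat) (s : seq nat) (P : set baire) :
  G setT -> forces G s [set x | forces G s P -> P x].
Proof.
move=> GT; have [sP|nsP] := pselect (forces G s P).
  by apply: forces_sub sP => x Px _.
by apply: forces_cylinder => // x _ /nsP.
Qed.

Lemma forces_rcons (G : set_system nat) (s : seq nat) (P : set baire) :
  G setT -> G [set n | forces G (rcons s n) P] -> forces G s P.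
Proof.
move=> GT Gs; pose W := [set n | forces G (rcons s n) P].
have [rho rhoG rhoP] := forces_choice (fun n => forces_imply (rcons s n) P GT).
exists (fun u => if size u <= size s then W else rho (nth 0 u (size s)) u).
  by move=> u; case: ifP.
move=> x [xs follow].
have Wx : W (x (size s)).
  by have := follow _ (leqnn _); rewrite size_mkseq leqnn.
apply: rhoP Wx; split; first exact: cylinder_rcons.
rewrite size_rcons => i lt_si; have := follow i (ltnW lt_si).
by rewrite size_mkseq leqNgt lt_si/= nth_mkseq.
Qed.

Section ForcesFilter.
Context (F : set_system nat) {F_filter : Filter F}.

Global Instance forces_filter (s : seq nat) : Filter (forces F s).
Proof.
split.
- by exists (fun=> setT) => // u; exact: filterT.
- move=> P Q [tau tauF tauP] [rho rhoF rhoQ].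
  exists (fun u => tau u `&` rho u); first by move=> u; exact: filterI.
  move=> x [xs follow].
  by split; [apply: tauP|apply: rhoQ]; split=> // i /follow[].
- by move=> P Q; exact: forces_sub.
Qed.

Lemma forces_fusion (s : seq nat) (P : seq nat -> set baire) :
  (forall u, forces F u (P u)) ->
  forces F s [set x | forall n, size s <= n -> P (mkseq x n) x].
Proof.
move=> /forces_choice[rho rhoF rhoP].
exists (fun u => [set n | forall i : 'I_(size u).+1, rho (take i u) u n]).
  move=> u; apply: (filter_forall (f := fun i : 'I_(size u).+1 => _)) => i.
  exact: rhoF.
move=> x [xs follow] n le_sn; apply: rhoP; split; first exact: cylinder_mkseq.
rewrite size_mkseq => i le_ni; have := follow i (leq_trans le_sn le_ni).
have n_i : n < (size (mkseq x i)).+1 by rewrite size_mkseq.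
by move=> /(_ (Ordinal n_i)); rewrite /= take_mkseq.
Qed.

End ForcesFilter.

Lemma positive_setT (F : set_system nat) : ~ F set0 -> positive F setT.
Proof. by rewrite /positive/= setCT. Qed.

Lemma open_determinacy (F : set_system nat) (s : seq nat) (P : set baire) :
  Filter F -> open P -> forces (positive F) s P \/ forces F s (~` P).
Proof.
move=> F_filter openP.
have [F0|/positive_setT posT] := pselect (F set0).
  by right; exists (fun=> set0) => // x [_ /(_ _ (leqnn _))].
pose wins u := forces (positive F) u P.
have [|losing_s] := pselect (wins s); [by left|right].
pose keep_losing u := [set n | ~ wins u -> ~ wins (rcons u n)].
have keep_losingF u : F (keep_losing u).
  have [winning_u|losing_u] := pselect (wins u).
    by apply: filterS filterT => n _ /(_ winning_u).
  have /contrapT : ~ positive F [set n | wins (rcons u n)].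
    by move/(forces_rcons posT).
  by apply: filterS => n + _.
exists keep_losing => // x [xs follow] Px.
have losing_x k : ~ wins (mkseq x (size s + k)).
  elim: k => [|k IH]; first by rewrite addn0 xs.
  by rewrite addnS mkseqS; apply: follow IH; rewrite leq_addr.
have [i /subnKC <- xiP] := open_contains_cylinder (size s) openP Px.
by apply: losing_x; exact: forces_cylinder xiP.
Qed.

Section DependentChoice.
Variables (S : Type) (G : set_system nat).
Variables (pos : S -> seq nat) (next : S -> set S).
Hypothesis size_next : forall a b, next a b -> size (pos a) < size (pos b).
Hypothesis forces_next :
  forall a, forces G (pos a) (\bigcup_(b in next a) cylinder (pos b)).

Definition update (a : S) (u : seq nat) : S :=
  xget (a : {classic S}) [set b | next a b /\ pos b = u].

Lemma update_id (a : S) (u : seq nat) :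
  (forall b, next a b -> pos b <> u) -> update a u = a.
Proof. by move=> a_u; apply: (@xgetPN {classic S}) => b [/a_u]. Qed.

Lemma update_next (a b : S) :
  next a b -> next a (update a (pos b)) /\ pos (update a (pos b)) = pos b.
Proof.
move=> ab; have := @xgetPex {classic S} a [set c | next a c /\ pos c = pos b].
by apply; exists b.
Qed.

(* [scanl rcons [::] u] lists the nonempty prefixes of [u]. *)
Definition stage (a : S) (u : seq nat) : S :=
  foldl update a (scanl rcons [::] u).

Lemma stage_rcons (a : S) (u : seq nat) n :
  stage a (rcons u n) = update (stage a u) (rcons u n).
Proof. by rewrite /stage scanl_rcons foldl_rcons foldl_rcons_cat. Qed.

Lemma stage_init (a : S) (u : seq nat) :
  size u <= size (pos a) -> stage a u = a.
Proof.
elim/last_ind: u => // u n IH; rewrite size_rcons stage_rcons => lt_ua.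
rewrite IH 1?ltnW//; apply: update_id => b /size_next + pos_b.
by rewrite pos_b size_rcons ltnNge lt_ua.
Qed.

Definition visited (a : S) (x : baire) (b : S) : Prop :=
  [/\ cylinder (pos b) x, stage a (pos b) = b & size (pos a) <= size (pos b)].

Lemma stage_wait (a : S) (x : baire) (b : S) k :
  visited a x b -> size (pos b) <= k ->
  (forall c, next b c -> cylinder (pos c) x -> k < size (pos c)) ->
  stage a (mkseq x k) = b.
Proof.
move=> [xb stage_b _] /subnKC <-.
elim: (k - _) => [|j IH]; first by rewrite addn0 xb.
rewrite addnS => wait.
rewrite mkseqS stage_rcons IH => [|c bc /(wait c bc)/ltnW //].
apply: update_id => c /wait + pos_c; rewrite pos_c -mkseqS size_mkseq ltnn.
by move=> /(_ (cylinder_mkseq _ _)).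
Qed.

Lemma visited_next (a : S) (x : baire) (b c : S) :
  visited a x b -> next b c -> cylinder (pos c) x ->
  exists2 d, next b d & visited a x d.
Proof.
move=> visited_b; have [n] := ubnP (size (pos c)).
elim: n c => // n IH c lt_cn bc xc.
have [[d [bd xd lt_dc]]|first_c] := pselect (exists d,
    [/\ next b d, cylinder (pos d) x & size (pos d) < size (pos c)]).
  by apply: IH bd xd; exact: leq_trans lt_dc _.
have := size_next bc; case size_c: (size (pos c)) => [//|m] le_bm.
have stage_b : stage a (mkseq x m) = b.
  apply: stage_wait visited_b le_bm _ => d bd xd.
  rewrite ltnNge; apply/negP => le_dm; apply: first_c.
  by exists d; rewrite size_c.
have stage_c : stage a (pos c) = update b (pos c).
  by rewrite -xc size_c mkseqS stage_rcons stage_b.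
have [bd pos_d] := update_next bc.
exists (update b (pos c)) => //; split; rewrite pos_d// size_c.
by case: visited_b => _ _ le_ab; exact/leqW/(leq_trans le_ab).
Qed.

Lemma plays_visited_next (tau : S -> seq nat -> set nat) (a : S) (x : baire)
    (b : S) :
  (forall c, plays (tau c) (pos c) `<=`
     \bigcup_(d in next c) cylinder (pos d)) ->
  plays (fun u => tau (stage a u) u) (pos a) x -> visited a x b ->
  exists2 c, next b c & visited a x c.
Proof.
move=> tauP [_ follow] visited_b; have [xb _ le_ab] := visited_b.
suff [c bc xc] : exists2 c, next b c & cylinder (pos c) x.
  exact: visited_next visited_b bc xc.
apply: contrapT => no_next; apply/no_next/tauP; split=> // i le_bi.
have <- : stage a (mkseq x i) = b; last exact/follow/(leq_trans le_ab).
by apply: stage_wait visited_b le_bi _ => c bc xc; case: no_next; exists c.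
Qed.

Lemma forces_dependent_choice (a : S) :
  forces G (pos a) [set x | exists f : nat -> S,
    [/\ f 0 = a, forall k, next (f k) (f k.+1) &
        forall k, cylinder (pos (f k)) x]].
Proof.
have [tau tauG tauP] := forces_choice forces_next.
exists (fun u => tau (stage a u) u) => // x playx.
have visited_a : visited a x a.
  by split=> //; [exact: playx.1|exact: stage_init].
pose R (b c : {b | visited a x b}) := next (sval b) (sval c).
have R_total b : {c | R b c}.
  apply: cid; have [c bc visited_c] := plays_visited_next tauP playx (svalP b).
  by exists (exist _ c visited_c).
have [f [f0 fS]] := dependent_choice R_total (exist _ a visited_a).
exists (sval \o f); split=> [|//|k]; first by rewrite /= f0.
by have [] := svalP (f k).
Qed.

End DependentChoice.

Definition projection_over (C : set (baire * baire)) (t : seq nat) :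
    set baire :=
  [set x | exists2 y, cylinder t y & C (x, y)].

Definition unavoidable (F : set_system nat) (s : seq nat) (P : set baire) :
    Prop :=
  ~ forces F s (~` P).

Lemma forces_unavoidable_rcons (F : set_system nat) (C : set (baire * baire))
    (s t : seq nat) : Filter F -> unavoidable F s (projection_over C t) ->
  forces (positive F) s (\bigcup_(u in [set u | size s < size u /\
    exists m, unavoidable F u (projection_over C (rcons t m))]) cylinder u).
Proof.
move=> F_filter; set B := [set u | _] => unavoid_s.
have openB : open (\bigcup_(u in B) cylinder u).
  by apply: bigcup_open => u _; exact: open_cylinder.
have [//|avoidB] := open_determinacy s F_filter openB.
exfalso; apply: unavoid_s.
pose avoided u (m : nat) : set baire :=
  [set x | forces F u (~` projection_over C (rcons t m)) ->
    ~ projection_over C (rcons t m) x].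
have /(forces_fusion s) fused u :
    forces F u [set x | forall m : 'I_(size u).+1, avoided u m x].
  by apply: (filter_forall (F := forces F u)) => m; exact: forces_imply filterT.
(* [fused] excludes [m := y (size t)] at nodes of length at least [m] only. *)
apply: filterS2 avoidB fused => x avoidB fused [y yt Cxy].
pose m := y (size t); pose i := maxn (size s).+1 m.
have m_i : m < (size (mkseq x i)).+1 by rewrite size_mkseq ltnS leq_maxr.
have lt_si : size s < i by exact: leq_maxl.
apply: (fused i (ltnW lt_si) (Ordinal m_i)) => /=.
  apply: contrapT => unavoid_m; apply: avoidB.
  exists (mkseq x i); last exact: cylinder_mkseq.
  by split; [rewrite size_mkseq|exists m].
by exists y => //; exact: cylinder_rcons.
Qed.

Lemma closed_cylinders (C : set (baire * baire)) (u t : nat -> seq nat)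
    (x y : baire) :
  closed C ->
  (forall k, k <= size (u k)) -> (forall k, k <= size (t k)) ->
  (forall k, cylinder (u k) x) -> (forall k, cylinder (t k) y) ->
  (forall k, cylinder (u k) `&` projection_over C (t k) !=set0) -> C (x, y).
Proof.
move=> closedC u_ge t_ge ux ty meetsC.
have /choice[z zP] k :
    exists z, [/\ cylinder (u k) z.1, cylinder (t k) z.2 & C z].
  by have [x' [ux' [y' ty' Cxy']]] := meetsC k; exists (x', y').
have z_cvg : ((z k).1, (z k).2) @[k --> \oo] --> (x, y).
  have zx : (z k).1 @[k --> \oo] --> x.
    by apply: (cvg_cylinder u_ge ux) => k; have [] := zP k.
  have zy : (z k).2 @[k --> \oo] --> y.
    by apply: (cvg_cylinder t_ge ty) => k; have [] := zP k.
  exact: cvg_pair zx zy.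
apply: (closed_cvg _ closedC) z_cvg.
by apply: nearW => k; rewrite -surjective_pairing; have [] := zP k.
Qed.

Lemma forces_positive_projection (F : set_system nat) (C : set (baire * baire))
    (s t : seq nat) : Filter F -> closed C ->
  unavoidable F s (projection_over C t) ->
  forces (positive F) s (projection_over C t).
Proof.
move=> F_filter closedC unavoid_st.
pose S := {a : seq nat * seq nat | unavoidable F a.1 (projection_over C a.2)}.
pose pos (a : S) := (sval a).1; pose approx (a : S) := (sval a).2.
pose next (a : S) := [set b : S | size (pos a) < size (pos b) /\
  exists m, approx b = rcons (approx a) m].
have forces_next a :
    forces (positive F) (pos a) (\bigcup_(b in next a) cylinder (pos b)).
  apply: forces_sub (forces_unavoidable_rcons F_filter (svalP a)).
  move=> x [u [lt_u [m unavoid_m]] ux].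
  by exists (exist _ (u, _) unavoid_m) => //; split=> //; exists m.
have size_next a b : next a b -> size (pos a) < size (pos b) by case.
apply: forces_sub (forces_dependent_choice size_next forces_next
  (exist _ (s, t) unavoid_st)) => x [f [f0 fS fx]].
have approxS k : exists m, approx (f k.+1) = rcons (approx (f k)) m.
  exact: (fS k).2.
have size_pos k : k <= size (pos (f k)).
  by elim: k => // k IH; exact: leq_ltn_trans IH (fS k).1.
have size_approx k : k <= size (approx (f k)).
  by elim: k => // k IH; have [m ->] := approxS k; rewrite size_rcons ltnS.
have [|y yf] := prefix_chain_branch (t := approx \o f) _ size_approx.
  by move=> k /=; have [m ->] := approxS k; exact: prefix_rcons.
exists y; first by have := yf 0; rewrite /= f0.
apply: (closed_cylinders closedC size_pos size_approx fx yf) => k.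
have [z zu /contrapT zt] := not_forces_escape filterT (svalP (f k)).
by exists z.
Qed.

Lemma Sigma11_determinacy (F : set_system nat) (s : seq nat) (A : set baire) :
  Filter F -> Sigma11 A -> forces F s (~` A) \/ forces (positive F) s A.
Proof.
move=> F_filter [C [closedC ->]].
have -> : [set x | exists y, C (x, y)] = projection_over C [::].
  by apply/seteqP; split=> x [y]; exists y.
have [|] := pselect (forces F s (~` projection_over C [::])); first by left.
by right; exact: forces_positive_projection.
Qed.

Theorem theorem8 (F : set_system nat) (F_filter : Filter F)
    (F_cofinite : forall X : set nat, cofinite_set X -> F X)
    (A : set baire) (A_Sigma11 : Sigma11 A) :
  (exists2 H : set (seq nat), HF F H & branches H `&` A = set0) \/
  (exists2 L : set (seq nat), LF F L & branches L `<=` A).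
Proof.
have [|] := Sigma11_determinacy [::] F_filter A_Sigma11.
  move=> /forces_tree[H HFH HA]; left.
  by exists H; rewrite ?disjoints_subset.
(* [LF F] is convertible to [HF (positive F)]. *)
by move=> /forces_tree; right.
Qed.
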